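(* If $X$ is a dictionaric type space or a dictionaric definable set, and $D$ and $E$ are definable subsets of $X$, then for every $\varepsilon>0$ there is a definable set $E'\supseteq E$ (with $E'\subseteq X$) such that $D\cap E'$ is definable and $d_H(E,E')<\varepsilon$.
   Context: Setting: continuous first-order logic for metric structures. $S_n(A)$ is the space of complete $n$-types over a parameter set $A$, a compact Hausdorff space under the logic topology, also equipped with the metric $d(p,q)=\inf\{d(\bar a,\bar b):\bar a\models p,\ \bar b\models q\}$ computed in a monster model. For $Q\subseteq S_n(A)$, $Q^{<\varepsilon}=\{q:d(q,Q)<\varepsilon\}$. $d_H(A,B)=\max\{\sup_{a\in A}d(a,B),\sup_{b\in B}d(b,A)\}$. A closed set $D\subseteq S_n(A)$ is definable if for every $\varepsilon>0$ there is an open $U$ with $D\subseteq U\subseteq D^{<\varepsilon}$. A type space or definable set $X$ is dictionaric if for every $p\in X$ and closed $F\subseteq X$ with $p\notin F$, there is a definable set $D\subseteq X$ such that $p\in\operatorname{int}_X D$ (interior relative to $X$ in the logic topology) and $D\cap F=\varnothing$. *)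

(* Defs.v *)
From HB Require Import structures.
From mathcomp Require Import all_boot all_order all_algebra.
From mathcomp Require Import all_classical all_reals all_analysis.

Set Implicit Arguments.
Unset Strict Implicit.
Unset Printing Implicit Defensive.

Import Order.TTheory GRing.Theory Num.Theory numFieldNormedType.Exports.
Local Open Scope classical_set_scope.
Local Open Scope card_scope.
Local Open Scope ring_scope.

(* Besides arities, a continuous signature fixes a bound on the diameter, a
   compact interval of values for each predicate symbol, and a modulus of
   uniform continuity for each symbol. *)
Record signature (R : realType) := Signature {
  diam : R;
  fsym : Type;
  farity : fsym -> nat;
  fmodulus : fsym -> R -> R;
  fmodulus_gt0 : forall f e, 0 < e -> 0 < fmodulus f e;
  psym : Type;
  parity : psym -> nat;
  plower : psym -> R;
  pupper : psym -> R;
  pmodulus : psym -> R -> R;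
  pmodulus_gt0 : forall P e, 0 < e -> 0 < pmodulus P e
}.

Definition tuple_dist (R : realType) (M : metricType R) (n : nat)
    (a b : 'I_n -> M) : R :=
  \big[Num.max/0]_(i < n) mdist (a i) (b i).

Record structure (R : realType) (L : signature R) := Structure {
  carrier :> metricType R;
  carrier_nonempty : [set: carrier] !=set0;
  carrier_complete : forall F : set_system carrier,
    ProperFilter F -> cauchy F -> exists x : carrier, F --> x;
  carrier_diam : forall x y : carrier, mdist x y <= diam L;
  finterp : forall f : fsym L, ('I_(farity f) -> carrier) -> carrier;
  finterp_uc : forall (f : fsym L) (e : R) (a b : 'I_(farity f) -> carrier),
    0 < e -> tuple_dist a b < fmodulus f e ->
    mdist (finterp a) (finterp b) <= e;
  pinterp : forall P : psym L, ('I_(parity P) -> carrier) -> R;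
  pinterp_bounds : forall (P : psym L) (a : 'I_(parity P) -> carrier),
    plower P <= pinterp a <= pupper P;
  pinterp_uc : forall (P : psym L) (e : R) (a b : 'I_(parity P) -> carrier),
    0 < e -> tuple_dist a b < pmodulus P e ->
    `|pinterp a - pinterp b| <= e
}.

(* Terms and formulas with parameters from C and free variables indexed by
   'I_n. Every continuous function R^k -> R is a connective; quantifiers bind
   the variable ord0 of a formula with n.+1 variables. *)
Inductive term (R : realType) (L : signature R) (C : Type) (n : nat) : Type :=
| Var of 'I_n
| Par of C
| App (f : fsym L) of ('I_(farity f) -> term L C n).

Inductive formula (R : realType) (L : signature R) (C : Type) (n : nat)
    : Type :=
| Dist of term L C n & term L C n
| Pred (P : psym L) of ('I_(parity P) -> term L C n)
| Conn (k : nat) (u : 'rV[R]_k -> R) of continuous u &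
    ('I_k -> formula L C n)
| Sup of formula L C n.+1
| Inf of formula L C n.+1.

Definition env_cons (T : Type) (n : nat) (x : T) (a : 'I_n -> T)
    : 'I_n.+1 -> T :=
  fun i => if unlift ord0 i is Some j then a j else x.

Fixpoint teval (R : realType) (L : signature R) (M : structure L) (C : Type)
    (c : C -> M) (n : nat) (a : 'I_n -> M) (t : term L C n) : M :=
  match t with
  | Var i => a i
  | Par x => c x
  | App f ts => finterp (fun i => teval c a (ts i))
  end.

Fixpoint feval (R : realType) (L : signature R) (M : structure L) (C : Type)
    (c : C -> M) (n : nat) (a : 'I_n -> M) (phi : formula L C n) : R :=
  match phi with
  | Dist t1 t2 => mdist (teval c a t1) (teval c a t2)
  | Pred P ts => pinterp (fun i => teval c a (ts i))
  | Conn k u _ phis => u (\row_i feval c a (phis i))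
  | Sup psi => sup [set feval c (env_cons x a) psi | x in [set: M]]
  | Inf psi => inf [set feval c (env_cons x a) psi | x in [set: M]]
  end.

Section TypeSpaces.
Context (R : realType) (L : signature R) (M : structure L).

(* L(A)-formulas in n variables; A is used as the type of its elements. *)
Definition pformula (A : set M) (n : nat) : Type := formula L A n.

Definition value (A : set M) (n : nat) (a : 'I_n -> M) (phi : pformula A n)
    : R :=
  feval (fun c : A => set_val c) a phi.

(* A complete n-type over A is encoded by the value it assigns to each
   L(A)-formula, i.e. as the set of conditions phi = p phi; it has to be
   finitely (approximately) satisfiable in M, equivalently consistent with the
   elementary diagram of M over A. *)
Definition is_type (A : set M) (n : nat) : set {ptws pformula A n -> R} :=
  [set p | forall (k : nat) (phi : 'I_k -> pformula A n) (e : R), 0 < e ->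
    exists a : 'I_n -> M, forall i, `|value a (phi i) - p (phi i)| < e].

(* S_n(A). The logic topology is the topology of pointwise convergence on
   formulas, restricted to types. *)
Local Notation type_space A n := (set_type (@is_type A n)).

Definition realizations (A : set M) (n : nat) (p : type_space A n)
    : set ('I_n -> M) :=
  [set a | forall phi, value a phi = set_val p phi].

(* kappa-saturation, where kappa is the cardinality of K. *)
Definition saturated (K : Type) : Prop :=
  forall (B : set M), ~~ ([set: K] #<= B) ->
  forall (n : nat) (p : type_space B n), realizations p !=set0.

(* The distances below are computed in M, which is meant to be a monster model.
   They are extended reals so that the distance to the empty set is +oo. *)
Definition type_dist (A : set M) (n : nat) (p q : type_space A n) : \bar R :=
  ereal_inf [set (tuple_dist a b)%:E | a in realizations p &
                                       b in realizations q].

Definition dist_to (A : set M) (n : nat) (p : type_space A n)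
    (Q : set (type_space A n)) : \bar R :=
  ereal_inf [set type_dist p q | q in Q].

Definition thickening (A : set M) (n : nat) (Q : set (type_space A n)) (e : R)
    : set (type_space A n) :=
  [set q | (dist_to q Q < e%:E)%E].

(* This is -oo, hence smaller than any e > 0, if both sets are empty, and +oo
   if exactly one of them is. *)
Definition hausdorff_dist (A : set M) (n : nat) (P Q : set (type_space A n))
    : \bar R :=
  Order.max (ereal_sup [set dist_to p Q | p in P])
            (ereal_sup [set dist_to q P | q in Q]).

Definition definable (A : set M) (n : nat) (D : set (type_space A n)) : Prop :=
  closed D /\
  forall e : R, 0 < e ->
    exists U, [/\ open U, D `<=` U & U `<=` thickening D e].

Definition dictionaric (A : set M) (n : nat) (X : set (type_space A n))
    : Prop :=
  forall (p : type_space A n) (F : set (type_space A n)),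
    X p -> closed F -> F `<=` X -> ~ F p ->
    exists D, [/\ definable D, D `<=` X,
      @interior (subspace X) D p & D `&` F = set0].

End TypeSpaces.

Notation type_space A n := (set_type (@is_type _ _ _ A n)).

(* Main.v *)
(* The type space is handled as a topometric space: it is compact Hausdorff, the
   closed s-thickening of a closed set is closed (compactness and saturation),
   and open thickenings of open sets are open (because inf_x of a formula is a
   formula); these two facts also give the triangle inequality for d.

   Compactness and dictionaricness interpolate a definable set between a closed
   subset of X and an open set containing it.  Start with a definable C_0 with
   D `&` E <= C_0, close to both D and E.  Given a definable C_k within e_k of D,
   interpolate C_{k+1} between the closed set of points of D at distance at most
   e_k from C_k and the open set of points close to C_k and within e_{k+1} of D.
   The metric limit C of the C_k is definable, close to E, and satisfies
   D `&` E <= C <= D.  Then E' := E `|` C works, because D `&` E' = C. *)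
Require Import Defs.
From HB Require Import structures.
From mathcomp Require Import all_boot all_order all_algebra.
From mathcomp Require Import all_classical all_reals all_analysis.
From mathcomp Require Import ring lra.

Set Implicit Arguments.
Unset Strict Implicit.
Unset Printing Implicit Defensive.

Import Order.TTheory GRing.Theory Num.Theory numFieldNormedType.Exports.
Local Open Scope classical_set_scope.
Local Open Scope card_scope.
Local Open Scope ring_scope.

(** * Formulas: bounds, iterated infima, renaming of variables, some connectives *)

Section Formulas.
Context (R : realType) (L : signature R) (M : structure L).

(** Ensures that [sup] and [inf] are taken over bounded sets. Uniformity in [a] carries the bound
    through quantifiers; a connective sends the compact box of values of its arguments to a bounded
    set. *)
Lemma feval_bounded (C : Type) n (phi : formula L C n) :
  exists B : R, forall (c : C -> M) a, `|feval c a phi| <= B.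
Proof.
elim: phi => {n} [n t1 t2|n P ts|n k u cu phis IH|n psi [B IH]|n psi [B IH]].
- exists (diam L) => c a /=.
  by rewrite ger0_norm ?mdist_ge0 // carrier_diam.
- exists (`|plower P| + `|pupper P|) => c a /=.
  have /andP[l1 l2] := pinterp_bounds (fun i => teval c a (ts i)).
  rewrite ler_norml; apply/andP; split.
    have := ler_norm (- plower P); rewrite normrN.
    have := normr_ge0 (pupper P); lra.
  have := ler_norm (pupper P); have := normr_ge0 (plower P); lra.
- have [B BP] := choice IH.
  pose box := [set v : 'rV[R]_k | forall i, `[- B i, B i]%classic (v ord0 i)].
  have cK : compact box.
    apply: (@rV_compact R k (fun i => `[- B i, B i]%classic)) => i.
    exact: segment_compact.
  have : compact (u @` box).
    by apply: continuous_compact => //; exact: continuous_subspaceT.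
  move=> /compact_bounded[M0 [_ MP]]; exists (M0 + 1) => c a /=.
  apply: (MP (M0 + 1)); first by rewrite ltrDl.
  exists (\row_i feval c a (phis i)) => // i /=.
  by rewrite mxE in_itv /= -ler_norml.
- exists B => c a /=.
  have [x0 _] := carrier_nonempty M.
  have hs : [set feval c (env_cons x a) psi | x in [set: M]] !=set0.
    by exists (feval c (env_cons x0 a) psi), x0.
  have ub : ubound [set feval c (env_cons x a) psi | x in [set: M]] B.
    by move=> _ [x _ <-]; have := IH c (env_cons x a); rewrite ler_norml => /andP[].
  rewrite ler_norml; apply/andP; split; last exact: ge_sup.
  apply: (@le_trans _ _ (feval c (env_cons x0 a) psi)).
    by have := IH c (env_cons x0 a); rewrite ler_norml => /andP[].
  by apply: ub_le_sup; [exists B | exists x0].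
- exists B => c a /=.
  have [x0 _] := carrier_nonempty M.
  have hs : [set feval c (env_cons x a) psi | x in [set: M]] !=set0.
    by exists (feval c (env_cons x0 a) psi), x0.
  have lb : lbound [set feval c (env_cons x a) psi | x in [set: M]] (- B).
    by move=> _ [x _ <-]; have := IH c (env_cons x a); rewrite ler_norml => /andP[].
  rewrite ler_norml; apply/andP; split; first exact: lb_le_inf.
  apply: (@le_trans _ _ (feval c (env_cons x0 a) psi)).
    by apply: ge_inf; [exists (- B) | exists x0].
  by have := IH c (env_cons x0 a); rewrite ler_norml => /andP[].
Qed.

Lemma feval_Inf_lt (C : Type) n (psi : formula L C n.+1) (c : C -> M) a t :
  feval c a (Inf psi) < t <-> exists x, feval c (env_cons x a) psi < t.
Proof.
have [x0 _] := carrier_nonempty M; split=> /=.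
  move=> /inf_lt -[|_ [x _ <-] lt]; last by exists x.
  by exists (feval c (env_cons x0 a) psi), x0.
move=> [x]; apply: le_lt_trans; apply: ge_inf; last by exists x.
have [B PB] := feval_bounded psi; exists (- B) => _ [y _ <-].
by have := PB c (env_cons y a); rewrite ler_norml => /andP[].
Qed.

(** Binds the first [m] variables and keeps the last [n]. The recursion is well typed because
    [m'.+1 + n] is convertible to [(m' + n).+1]. *)
Fixpoint Infs (C : Type) m n : formula L C (m + n) -> formula L C n :=
  match m with
  | 0 => id
  | m'.+1 => fun phi => @Infs C m' n (Inf phi)
  end.

Lemma feval_Infs_lt (C : Type) m n (phi : formula L C (m + n)) (c : C -> M) b t :
  feval c b (Infs phi) < t <->
  exists e, (forall i, e (rshift m i) = b i) /\ feval c e phi < t.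
Proof.
elim: m phi => [|m IH] phi /=.
  split=> [lt|[e [eb lt]]].
    by exists b; split=> // i; congr b; apply: val_inj.
  suff <- : e = b by [].
  by apply/funext => i; rewrite -eb; congr e; apply: val_inj.
rewrite IH; split.
  move=> [e [eb /feval_Inf_lt[x lt]]]; exists (env_cons x e); split=> // i.
  have -> : rshift m.+1 i = lift ord0 (rshift m i) by exact: val_inj.
  by rewrite /env_cons liftK.
move=> [e [eb lt]]; exists (fun i => e (lift ord0 i)); split.
  by move=> i; rewrite -eb; congr e; exact: val_inj.
apply/feval_Inf_lt; exists (e ord0).
suff -> : env_cons (e ord0) (fun i => e (lift ord0 i)) = e by [].
apply/funext => i; rewrite /env_cons.
by case: unliftP => [j|] ->.
Qed.

Fixpoint trename (C : Type) m n (f : 'I_m -> 'I_n) (t : term L C m) : term L C n :=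
  match t with
  | Var i => @Var _ _ _ _ (f i)
  | Par x => @Par _ _ _ _ x
  | App g ts => App (fun i => trename f (ts i))
  end.

Definition lift_map m n (f : 'I_m -> 'I_n) : 'I_m.+1 -> 'I_n.+1 :=
  fun i => if unlift ord0 i is Some j then lift ord0 (f j) else ord0.

(** The target [n] and the map come after the formula, so that the recursion can pass under a
    quantifier with [lift_map f], which fixes the bound variable. *)
Fixpoint frename (C : Type) m (phi : formula L C m) :
    forall n, ('I_m -> 'I_n) -> formula L C n :=
  match phi with
  | Dist t1 t2 => fun n f => Dist (trename f t1) (trename f t2)
  | Pred P ts => fun n f => Pred (fun i => trename f (ts i))
  | Conn k u cu phis => fun n f => Conn cu (fun i => frename (phis i) f)
  | Sup psi => fun n f => Sup (frename psi (lift_map f))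
  | Inf psi => fun n f => Inf (frename psi (lift_map f))
  end.

Lemma teval_rename (C : Type) m n (f : 'I_m -> 'I_n) (c : C -> M) a
    (t : term L C m) :
  teval c a (trename f t) = teval c (a \o f) t.
Proof.
by elim: t => [i|x|g ts IH] //=; congr finterp; apply/funext => i; exact: IH.
Qed.

Lemma env_cons_lift (T : Type) m n (f : 'I_m -> 'I_n) (x : T) a :
  env_cons x a \o lift_map f = env_cons x (a \o f).
Proof.
apply/funext => i; rewrite /env_cons /lift_map /=.
by case: (unliftP ord0 i) => [j|] _; rewrite ?liftK ?unlift_none.
Qed.

Lemma feval_rename (C : Type) m (phi : formula L C m) n (f : 'I_m -> 'I_n)
    (c : C -> M) a :
  feval c a (frename phi f) = feval c (a \o f) phi.
Proof.
elim: phi n f a => {m} [m t1 t2|m P ts|m k u cu phis IH|m psi IH|m psi IH] n f a /=.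
- by rewrite !teval_rename.
- by congr pinterp; apply/funext => i; rewrite teval_rename.
- by congr u; apply/rowP => i; rewrite !mxE IH.
- congr sup; apply/seteqP; split=> _ [x _ <-]; exists x => //;
    by rewrite IH env_cons_lift.
- congr inf; apply/seteqP; split=> _ [x _ <-]; exists x => //;
    by rewrite IH env_cons_lift.
Qed.

Lemma max_coord_continuous (i j : 'I_2) :
  continuous (fun v : 'rV[R]_2 => Num.max (v ord0 i) (v ord0 j)).
Proof.
move=> v.
have ci k : {for v, continuous (fun v : 'rV[R]_2 => v ord0 k : R^o)}.
  exact: (@coord_continuous R 1 2 ord0 k v).
exact: (continuous_max (ci i) (ci j)).
Qed.

Definition Fmax (C : Type) n (phi psi : formula L C n) : formula L C n :=
  Conn (@max_coord_continuous ord0 ord_max)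
    (fun i => if i == ord0 then phi else psi).

Lemma feval_Fmax (C : Type) n (phi psi : formula L C n) (c : C -> M) a :
  feval c a (Fmax phi psi) = Num.max (feval c a phi) (feval c a psi).
Proof. by rewrite /= !mxE. Qed.

Lemma shift_coord_continuous (r : R) :
  continuous (fun v : 'rV[R]_1 => v ord0 ord0 - r).
Proof.
move=> v; apply: (@continuousB R R^o _ (fun v : 'rV[R]_1 => v ord0 ord0) (cst r)).
  exact: (@coord_continuous R 1 1 ord0 ord0 v).
exact: cst_continuous.
Qed.

Definition Fsub (C : Type) n (phi : formula L C n) (r : R) : formula L C n :=
  Conn (@shift_coord_continuous r) (fun=> phi).

Lemma feval_Fsub (C : Type) n (phi : formula L C n) r (c : C -> M) a :
  feval c a (Fsub phi r) = feval c a phi - r.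
Proof. by rewrite /= !mxE. Qed.

Lemma dist_coord_continuous (r : R) :
  continuous (fun v : 'rV[R]_1 => `|v ord0 ord0 - r|).
Proof.
move=> v; exact: (cvg_norm (@shift_coord_continuous r v)).
Qed.

Definition Fdev (C : Type) n (phi : formula L C n) (r : R) : formula L C n :=
  Conn (@dist_coord_continuous r) (fun=> phi).

Lemma feval_Fdev (C : Type) n (phi : formula L C n) r (c : C -> M) a :
  feval c a (Fdev phi r) = `|feval c a phi - r|.
Proof. by rewrite /= !mxE. Qed.

Lemma bigmax_coord_continuous k :
  continuous (fun v : 'rV[R]_k => \big[Num.max/0]_(i < k) v ord0 i).
Proof.
move=> v.
elim: (index_enum _) => [|i s IH].
  by under eq_fun do rewrite big_nil; exact: cst_continuous.
under eq_fun do rewrite big_cons.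
have ci : {for v, continuous (fun v : 'rV[R]_k => v ord0 i : R^o)}.
  exact: (@coord_continuous R 1 k ord0 i v).
exact: (continuous_max ci IH).
Qed.

(** [f] and [g] select two subtuples of one [m]-tuple; the distance between two tuples thus becomes
    a formula in their concatenation. *)
Definition Ftdist (C : Type) m n (f g : 'I_n -> 'I_m) : formula L C m :=
  Conn (@bigmax_coord_continuous n)
    (fun i => Dist (@Var _ _ _ _ (f i)) (@Var _ _ _ _ (g i))).

Lemma feval_Ftdist (C : Type) m n (f g : 'I_n -> 'I_m) (c : C -> M) a :
  feval c a (Ftdist C f g) = tuple_dist (a \o f) (a \o g).
Proof. by rewrite /=; apply: eq_bigr => i _; rewrite mxE. Qed.

End Formulas.

(** * The maximum metric on tuples *)

Section TupleDist.
Context (R : realType) (T : metricType R) (n : nat).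
Implicit Types a b c : 'I_n -> T.

Lemma tuple_dist_ge0 a b : 0 <= tuple_dist a b.
Proof. exact: bigmax_ge_id. Qed.

Lemma mdist_le_tuple a b i : mdist (a i) (b i) <= tuple_dist a b.
Proof. exact: (le_bigmax _ (fun i => mdist (a i) (b i))). Qed.

Lemma tuple_dist_le a b e : 0 <= e -> (forall i, mdist (a i) (b i) <= e) ->
  tuple_dist a b <= e.
Proof. by move=> e0 le; apply: bigmax_le => // i _; exact: le. Qed.

Lemma tuple_distxx a : tuple_dist a a = 0.
Proof.
apply/eqP; rewrite eq_le tuple_dist_ge0 andbT.
by apply: tuple_dist_le => // i; rewrite mdistxx.
Qed.

Lemma tuple_dist_sym a b : tuple_dist a b = tuple_dist b a.
Proof. by apply: eq_bigr => i _; rewrite metric_sym. Qed.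

Lemma tuple_dist_triangle b a c : tuple_dist a c <= tuple_dist a b + tuple_dist b c.
Proof.
apply: tuple_dist_le => [|i]; first by rewrite addr_ge0 ?tuple_dist_ge0.
by rewrite (le_trans (metric_triangle _ (b i) _))// lerD ?mdist_le_tuple.
Qed.

Lemma tuple_dist_le0 a b : tuple_dist a b <= 0 -> a = b.
Proof.
move=> ab; apply/funext => i; apply: mdist_positivity; apply/eqP.
by rewrite eq_le mdist_ge0 andbT (le_trans (mdist_le_tuple a b i)).
Qed.

End TupleDist.

(** * Concatenation of tuples *)

Section OrdJoin.
Context (T : Type) (m n : nat).

Definition ord_join (a : 'I_m -> T) (b : 'I_n -> T) : 'I_(m + n) -> T :=
  fun i => match fintype.split i with inl j => a j | inr j => b j end.

Lemma ord_join_lshift a b : ord_join a b \o @lshift m n = a.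
Proof.
apply/funext => j; rewrite /ord_join /=.
by have := unsplitK (inl j : 'I_m + 'I_n); rewrite /unsplit => ->.
Qed.

Lemma ord_join_rshift a b : ord_join a b \o @rshift m n = b.
Proof.
apply/funext => j; rewrite /ord_join /=.
by have := unsplitK (inr j : 'I_m + 'I_n); rewrite /unsplit => ->.
Qed.

End OrdJoin.

(** * Types of tuples and the logic topology *)

Section Types.
Context (R : realType) (L : signature R) (M : structure L) (A : set M).

Lemma value_is_type n (a : 'I_n -> M) : is_type (value (A := A) a).
Proof. by move=> k phi e e0; exists a => i; rewrite subrr normr0. Qed.

Definition tp n (a : 'I_n -> M) : type_space A n :=
  SigSub (mem_set (value_is_type a)).

Lemma tpE n (a : 'I_n -> M) (phi : pformula A n) : set_val (tp a) phi = value a phi.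
Proof. by []. Qed.

Lemma value_Fmax n (phi psi : pformula A n) a :
  value a (Fmax phi psi) = Num.max (value a phi) (value a psi).
Proof. exact: feval_Fmax. Qed.

Lemma value_Fsub n (phi : pformula A n) r a :
  value a (Fsub phi r) = value a phi - r.
Proof. exact: feval_Fsub. Qed.

Lemma value_Fdev n (phi : pformula A n) r a :
  value a (Fdev phi r) = `|value a phi - r|.
Proof. exact: feval_Fdev. Qed.

Lemma value_Ftdist m n (f g : 'I_n -> 'I_m) a :
  value a (Ftdist L A f g) = tuple_dist (a \o f) (a \o g).
Proof. exact: feval_Ftdist. Qed.

Lemma value_rename m n (f : 'I_m -> 'I_n) (phi : pformula A m) a :
  value a (frename phi f) = value (a \o f) phi.
Proof. exact: feval_rename. Qed.

Lemma realizationsE n (p : type_space A n) a : realizations p a <-> tp a = p.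
Proof.
split=> [ra|<-] //; apply: val_inj; apply/funext => phi; exact: ra.
Qed.

Lemma ev_continuous n (phi : pformula A n) :
  continuous (fun p : type_space A n => set_val p phi : R).
Proof.
have c1 : continuous (set_val : type_space A n -> {ptws pformula A n -> R}).
  exact: initial_continuous.
have c2 : continuous (fun f : {ptws pformula A n -> R} => f phi).
  exact: (@proj_continuous {classic pformula A n} (fun=> R) phi).
move=> p; exact: (@continuous_comp _ _ _
  (set_val : type_space A n -> {ptws pformula A n -> R})
  (fun f : {ptws pformula A n -> R} => f phi) p (c1 p) (c2 _)).
Qed.

(** The topology on types is induced from a product, so convergence is tested formula by formula. *)
Lemma cvg_types n (F : set_system (type_space A n)) (p : type_space A n) :
  Filter F ->
  (forall phi, (fun q : type_space A n => set_val q phi : R) @ F -->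
               (set_val p phi : R)) ->
  F --> p.
Proof.
move=> FF cv W; rewrite nbhsE => -[_ [[B oB <-] Bp] sB].
apply: filterS sB _.
have cvp : (set_val : type_space A n -> {ptws pformula A n -> R}) @ F -->
    (set_val p : {ptws pformula A n -> R}).
  apply/cvg_sup => phi V; rewrite nbhsE => -[_ [[B' oB' <-] Bp'] sB'].
  rewrite /= !nbhs_simpl /=; apply: filterS (fun q => sB' (set_val q)) _.
  by apply: (cv phi); exact: open_nbhs_nbhs.
apply: (cvp B); exact: open_nbhs_nbhs.
Qed.

Lemma hausdorff_types n : hausdorff_space (type_space A n).
Proof.
move=> p q cl; apply: val_inj; apply/funext => phi.
apply: (@Rhausdorff R) => V W Vp Wq.
have [r [Vr Wr]] :=
  cl _ _ (@ev_continuous n phi p _ Vp) (@ev_continuous n phi q _ Wq).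
by exists (set_val r phi).
Qed.

Lemma closed_type1 n (p : type_space A n) : closed [set p].
Proof.
exact: accessible_closed_set1 (hausdorff_accessible (@hausdorff_types n)) p.
Qed.

Lemma ultra_cvg_bounded T (U : set_system T) (g : T -> R) (B : R) : UltraFilter U ->
  (forall x, `|g x| <= B) -> exists l : R, g @ U --> l.
Proof.
move=> UU gB.
have gU : (g @ U) `[- B, B]%classic.
  apply: (@filterE _ U) => x; rewrite /= in_itv /=; move: (gB x).
  by rewrite ler_norml.
have [l [_ cl]] := @segment_compact R (- B) B (g @ U) _ gU.
exists l => V Vl; have [//|UnV] := in_ultra_setVsetC (g @^-1` V) UU.
by have [x []] := cl (~` V) V UnV Vl.
Qed.

(** * Consequences of saturation: ultralimits of tuples, compactness, exchange *)

Section Saturated.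
Context (sat : forall n (p : type_space A n), realizations p !=set0).

Lemma tp_surj n (p : type_space A n) : exists a, tp a = p.
Proof. by have [a /realizationsE ap] := sat p; exists a. Qed.

(** The ultralimits of the values of formulas are finitely approximately satisfied along [U], so
    they form a type, which saturation realizes. *)
Lemma ultra_limit m (U : set_system ('I_m -> M)) : UltraFilter U ->
  exists a, forall phi : pformula A m,
    (fun b => value b phi) @ U --> (value a phi : R).
Proof.
move=> UU.
have /choice[p pP] : forall phi : pformula A m, exists l : R,
    (fun b => value b phi) @ U --> l.
  move=> phi; have [B PB] := feval_bounded M phi.
  by apply: (@ultra_cvg_bounded _ _ _ B) => b; exact: PB.
have pt : is_type p.
  move=> k phi e e0.
  have /filter_ex[a Pa] : \forall b \near U, forall i,
      `|value b (phi i) - p (phi i)| < e.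
    apply: filter_forall => i.
    have := pP (phi i); move=> /cvgr_dist_lt /(_ _ e0).
    by apply: filterS => b; rewrite distrC.
  by exists a.
have [a ra] := sat (SigSub (mem_set pt)).
by exists a => phi; rewrite (ra phi); exact: pP.
Qed.

(** One limit tuple serves all its subtuples, because a formula about a subtuple becomes, by
    renaming, a formula about the whole tuple. *)
Lemma ultra_limit_tp m (U : set_system ('I_m -> M)) : UltraFilter U ->
  exists a,
    (forall phi : pformula A m, (fun b => value b phi) @ U --> (value a phi : R))
    /\ forall n (f : 'I_n -> 'I_m),
      (fun b : 'I_m -> M => tp (b \o f) : type_space A n) @ U -->
      (tp (a \o f) : type_space A n).
Proof.
move=> UU; have [a aP] := ultra_limit UU; exists a; split=> // n f.
apply: cvg_types => phi.
have := aP (frename phi f); rewrite value_rename.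
by under eq_fun do rewrite value_rename.
Qed.

Lemma compact_types n : compact [set: type_space A n].
Proof.
(* A section of [tp] transports the filter to tuples, where ultralimits exist. *)
have /choice[r rP] := @tp_surj n.
move=> F FF _; have [G [UG FG]] := ultraFilterLemma (fmap_proper_filter r FF).
have [a [_ /(_ n id) aP]] := ultra_limit_tp UG; exists (tp a); split=> // P V FP Va.
have /filter_ex[b [Pb Vb]] : G (r @` P `&` (fun b => tp b) @^-1` V).
  apply: filterI; last exact: aP.
  by apply: FG; apply: (@filterS _ F _ P) => // q Pq; exists q.
case: Pb => q Pq qb; exists q; split=> //.
by rewrite -(rP q) qb.
Qed.

(** Conditions [phi < e] with [phi <= 0] at [a] are closed under conjunction through [Fmax]. They
    include the deviations [Fdev], so the filter they generate converges to [tp a]. *)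
Lemma tp_basis n (W : set (type_space A n)) a : open W -> W (tp a) ->
  exists (phi : pformula A n) (e : R), [/\ 0 < e, value a phi <= 0 &
    forall b, value b phi < e -> W (tp b)].
Proof.
move=> oW Wa.
pose I := (pformula A n * R)%type.
pose D := [set x : I | 0 < x.2 /\ value a x.1 <= 0].
pose B (x : I) := [set q : type_space A n | (set_val q x.1 : R) < x.2].
have FF : Filter (filter_from D B).
  apply: filter_from_filter.
    exists (Ftdist L A (fun i : 'I_n => i) id, 1); split=> //.
    by rewrite value_Ftdist tuple_distxx.
  move=> [phi e] [psi d] [e0 pa] [d0 qa].
  exists (Fmax phi psi, Num.min e d).
    by split; rewrite ?value_Fmax ?lt_min ?ge_max ?pa ?e0.
  move=> q; have [b <-] := tp_surj q.
  rewrite /B /mkset tpE value_Fmax lt_min !gt_max => /andP[/andP[? _] /andP[_ ?]].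
  by split; rewrite /mkset tpE.
have cv : filter_from D B --> tp a.
  apply: cvg_types => phi; apply/cvgrPdist_lt => e e0.
  exists (Fdev phi (value a phi), e).
    by split=> //; rewrite value_Fdev subrr normr0.
  move=> q; have [b <-] := tp_surj q.
  by rewrite /B /mkset tpE value_Fdev distrC.
have [[phi e] [/= e0 pa] sW] := cv W (open_nbhs_nbhs (conj oW Wa)).
exists phi, e; split=> // b lt; exact: (sW (tp b)).
Qed.

(** Compactness turns approximate pairs into an exact one. Pairs are coded as [(n + n)]-tuples; an
    ultralimit keeps the closed condition, has second type [q] by Hausdorffness, and obeys the
    distance bound because the distance is a formula. *)
Lemma approx_pair n (F : set (type_space A n)) (q : type_space A n) (s : R) :
  closed F ->
  (forall V e, nbhs q V -> 0 < e ->
    exists a b, [/\ F (tp a), V (tp b) & tuple_dist a b < s + e]) ->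
  exists a b, [/\ F (tp a), tp b = q & tuple_dist a b <= s].
Proof.
move=> cF ap.
pose fl := @lshift n n; pose fr := @rshift n n.
pose D := [set x : set (type_space A n) * R | nbhs q x.1 /\ 0 < x.2].
pose B (x : set (type_space A n) * R) := [set c : 'I_(n + n) -> M |
  [/\ F (tp (c \o fl)), x.1 (tp (c \o fr)) &
    tuple_dist (c \o fl) (c \o fr) < s + x.2]].
have FF : ProperFilter (filter_from D B).
  apply: filter_from_proper.
    apply: filter_from_filter.
      by exists (setT, 1); split=> //; exact: filterT.
    move=> [V e] [W d] [/= Vq e0] [/= Wq d0]; exists (V `&` W, Num.min e d).
      by split=> /=; [exact: filterI | rewrite lt_min e0].
    move=> c [/= Fc [Vc Wc] lt]; split; split=> //=.
      by rewrite (lt_le_trans lt)// lerD2l ge_min lexx.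
    by rewrite (lt_le_trans lt)// lerD2l ge_min lexx orbT.
  move=> [V e] [/= Vq e0]; have [a [b [Fa Vb lt]]] := ap V e Vq e0.
  by exists (ord_join a b); split; rewrite ?ord_join_lshift ?ord_join_rshift.
have [U [UU FU]] := ultraFilterLemma FF.
have [c [cv cvt]] := ultra_limit_tp UU.
have UB V e : nbhs q V -> 0 < e -> U (B (V, e)).
  by move=> Vq e0; apply: FU; exists (V, e).
exists (c \o fl), (c \o fr); split.
- apply: (@closed_cvg _ _ _ _ (fun b : 'I_(n + n) -> M => tp (b \o fl)) F cF
    _ _ (cvt n fl)).
  by apply: filterS (UB setT 1 filterT ltr01) => b [].
- have cq : (fun b : 'I_(n + n) -> M => tp (b \o fr)) @ U --> q.
    move=> V Vq; have UV := UB V 1 Vq ltr01.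
    by apply: (@filterS _ U _ (B (V, 1))) UV => b [].
  exact: (cvg_unique (@hausdorff_types n) (cvt n fr) cq).
- have := cv (Ftdist L A fl fr); rewrite value_Ftdist.
  move=> /cvgrPdist_lt cvd; apply/ler_addgt0Pr => e e0.
  have e20 : 0 < e / 2 by rewrite divr_gt0.
  have [b [[_ _ /= lt] near]] := @filter_ex _ U _ _
    (@filterI _ U _ _ _ (UB setT _ filterT e20) (cvd _ e20)).
  move: near lt; rewrite value_Ftdist ltr_norml => /andP[_]; lra.
Qed.

(** Only the type of [b'] is controlled, not its distance to [b]. This yields open thickenings, and
    in the triangle inequality it replaces moving tuples by automorphisms. *)
Lemma exchange n (W : set (type_space A n)) (a b : 'I_n -> M) (t : R) :
  open W -> W (tp a) -> tuple_dist a b < t ->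
  exists V, [/\ open V, V (tp b) &
    forall b', V (tp b') -> exists a', W (tp a') /\ tuple_dist a' b' < t].
Proof.
move=> oW Wa ab; have [phi [e [e0 pa sW]]] := tp_basis oW Wa.
pose fl := @lshift n n; pose fr := @rshift n n.
(* [Infs psi] is the formula inf_x max(phi(x), d(x, y) - d(a, b)) in y. *)
pose psi : pformula A (n + n) :=
  Fmax (frename phi fl) (Fsub (Ftdist L A fl fr) (tuple_dist a b)).
(* Below [d], the first bound forces the type into [W] and the second keeps the distance below
   [t]. *)
pose d := Num.min e (t - tuple_dist a b).
exists [set q : type_space A n | set_val q (Infs psi : pformula A n) < d]; split.
- have -> : [set q : type_space A n | set_val q (Infs psi : pformula A n) < d] =
    (fun q : type_space A n => set_val q (Infs psi : pformula A n) : R)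
      @^-1` [set x | x < d] by [].
  apply: open_comp => [q _|]; [exact: ev_continuous | exact: open_lt].
- rewrite /mkset tpE; apply/feval_Infs_lt.
  exists (ord_join a b); split.
    by move=> j; have /(congr1 (fun f => f j)) := ord_join_rshift a b.
  rewrite -/(value _ psi) value_Fmax value_rename value_Fsub value_Ftdist.
  rewrite ord_join_lshift ord_join_rshift subrr.
  have d0 : 0 < d by rewrite lt_min e0 subr_gt0.
  by rewrite gt_max d0 andbT; exact: le_lt_trans pa d0.
move=> b'; rewrite /mkset tpE => /feval_Infs_lt[c [cb]].
rewrite -/(value _ psi) value_Fmax value_rename value_Fsub value_Ftdist.
have -> : c \o fr = b' by apply/funext => j; exact: cb.
rewrite gt_max /d !lt_min => /andP[/andP[lte _] /andP[_ lt]].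
exists (c \o fl); split; first exact: sW.
move: lt; lra.
Qed.

End Saturated.
End Types.

(** * Thickenings and definable sets *)

Section Thickenings.
Context (R : realType) (L : signature R) (M : structure L) (A : set M).
Context (sat : forall n (p : type_space A n), realizations p !=set0).
Context (n : nat).
Local Notation tp := (@tp R L M A n).
Implicit Types (P Q : set (type_space A n)) (e s t : R).

(** As the inequality is strict, one witnessing pair replaces both nested infima, whether or not
    they are attained. *)
Lemma thickeningP Q e q : thickening Q e q <->
  exists a b, [/\ Q (tp a), tp b = q & tuple_dist a b < e].
Proof.
split.
  move=> /ereal_inf_lt[_ [p Qp <-]].
  move=> /ereal_inf_lt[_ [b /realizationsE bq [a /realizationsE ap <-]]].
  by rewrite lte_fin => lt; exists a, b; split; rewrite ?ap // tuple_dist_sym.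
move=> [a [b [Qa <- lt]]]; rewrite /thickening /mkset.
apply: le_lt_trans (_ : ((tuple_dist b a)%:E < _)%E); last first.
  by rewrite lte_fin tuple_dist_sym.
apply: le_trans (_ : (type_dist (tp b) (tp a) <= _)%E).
  by apply: ereal_inf_lbound; exists (tp a).
by apply: ereal_inf_lbound; exists b => //; exists a.
Qed.

Lemma thickeningS P Q s t : P `<=` Q -> s <= t ->
  thickening P s `<=` thickening Q t.
Proof.
move=> PQ st q /thickeningP[a [b [Pa bq lt]]]; apply/thickeningP.
by exists a, b; split; [exact: PQ | | exact: lt_le_trans st].
Qed.

Lemma sub_thickening Q e : 0 < e -> Q `<=` thickening Q e.
Proof.
move=> e0 q; have [a <-] := tp_surj sat q => Qa.
by apply/thickeningP; exists a, a; rewrite tuple_distxx.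
Qed.

Lemma thickening_open Q e : open Q -> open (thickening Q e).
Proof.
move=> oQ; rewrite openE => q /thickeningP[a [b [Qa <- lt]]].
have [V [oV Vb VP]] := exchange sat oQ Qa lt.
rewrite /interior nbhsE; exists V; first by split.
move=> r; have [b' <-] := tp_surj sat r => /VP[a' [Qa' lt']].
by apply/thickeningP; exists a', b'.
Qed.

(** The middle type has two realizations [b] and [b'] that may differ. [exchange] finds, near [b], a
    substitute for [c] up to a small error in type and distance; [approx_pair] for the closed set
    [[set tp a]] removes the error. *)
Lemma thickeningD Q s t : thickening (thickening Q s) t `<=` thickening Q (s + t).
Proof.
move=> r /thickeningP[b' [c [/thickeningP[a [b [Qa bb' lt1]]] cr lt2]]].
have [||a' [c' [a'a c'r le]]] := @approx_pair _ _ _ _ sat _ [set tp a] r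
    (tuple_dist a b + tuple_dist b' c).
- exact: closed_type1.
- move=> V e Vr e0.
  have [W [_ Wb WP]] : exists W, [/\ open W, W (tp b') &
      forall b0, W (tp b0) -> exists a0, V° (tp a0) /\
        tuple_dist a0 b0 < tuple_dist b' c + e].
    apply: exchange (_ : V° (tp c)) _ => //; first exact: open_interior.
      by rewrite cr.
    by rewrite tuple_dist_sym ltrDl.
  have [|c' [Vc' lt]] := WP b; first by rewrite bb'.
  exists a, c'; split=> //; first exact: interior_subset Vc'.
  rewrite (le_lt_trans (tuple_dist_triangle b _ _))// (tuple_dist_sym b) -addrA.
  by rewrite ltrD2l.
apply/thickeningP; exists a', c'; split=> //; first by rewrite a'a.
by rewrite (le_lt_trans le)// ltrD.
Qed.

(** The types at distance at most [s] from [Q], in a form that does not ask for the distance to be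
    attained. *)
Definition cthickening Q s : set (type_space A n) :=
  [set q | forall e, 0 < e -> thickening Q (s + e) q].

Lemma thickening_sub_cthickening Q s : thickening Q s `<=` cthickening Q s.
Proof.
by move=> q sq e e0; apply: thickeningS sq => //; rewrite lerDl ltW.
Qed.

Lemma cthickening_sub_thickening Q s t : s < t ->
  cthickening Q s `<=` thickening Q t.
Proof.
by move=> st q /(_ (t - s)); rewrite subr_gt0 subrKC; exact.
Qed.

Lemma cthickening_closed Q s : closed Q -> closed (cthickening Q s).
Proof.
move=> cQ q clq e e0.
have [|a [b [Qa bq le]]] := @approx_pair _ _ _ _ sat _ Q q s cQ.
  move=> V d Vq d0.
  have [r [/(_ _ d0)/thickeningP[a [b [Qa br lt]]] Vr]] := clq V Vq.
  by exists a, b; rewrite br.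
by apply/thickeningP; exists a, b; split=> //; rewrite (le_lt_trans le)// ltrDl.
Qed.

(** Logically closed sets are metrically closed: [approx_pair] with bound 0 gives two equal
    tuples. *)
Lemma closed_thickeningI Q q : closed Q ->
  (forall e, 0 < e -> thickening Q e q) -> Q q.
Proof.
move=> cQ Qq.
have [|a [b [Qa <- le]]] := @approx_pair _ _ _ _ sat _ Q q 0 cQ.
  move=> V e Vq e0; have /thickeningP[a [b [Qa bq lt]]] := Qq e e0.
  by exists a, b; rewrite bq add0r; split=> //; exact: nbhs_singleton.
by rewrite -(tuple_dist_le0 le).
Qed.

Lemma definableU P Q : definable P -> definable Q -> definable (P `|` Q).
Proof.
move=> [cP dP] [cQ dQ]; split; first exact: closedU.
move=> e e0; have [U [oU PU Ue]] := dP e e0; have [V [oV QV Ve]] := dQ e e0.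
exists (U `|` V); split; [exact: openU | exact: setUSS |].
by move=> q [/Ue|/Ve]; apply: thickeningS => //.
Qed.

Lemma definable0 : definable (set0 : set (type_space A n)).
Proof.
split=> [|e e0]; first exact: closed0.
by exists set0; split=> //; exact: open0.
Qed.

(** A third of the gap [t - s] goes to an open set around [P], another third to enlarging the
    thickening of that set, which is again open. *)
Lemma definable_nbhs P s t : definable P -> s < t ->
  exists U, [/\ open U, cthickening P s `<=` U & U `<=` thickening P t].
Proof.
move=> [_ dP] st; pose d := (t - s) / 3.
have d0 : 0 < d by rewrite divr_gt0// subr_gt0.
have [U [oU PU UP]] := dP d d0; exists (thickening U (s + d)); split.
- exact: thickening_open.
- move=> q Pq; apply: thickeningS PU _ _ (Pq d d0) => //.
- move=> q Uq.
  have : thickening (thickening P d) (s + d) q by exact: thickeningS Uq.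
  by move=> /thickeningD; apply: thickeningS => //; rewrite /d; lra.
Qed.

(** A finite covering argument in terms of filters: the candidates [C] are closed under union, so if
    none contains [G], their complements in [G] generate a proper filter. At a cluster point, a
    definable neighbourhood avoiding the complement of [U] in [X] gives a contradiction. *)
Lemma dictionaric_cover (X G U : set (type_space A n)) :
  closed X -> dictionaric X -> closed G -> open U -> G `<=` X -> G `<=` U ->
  exists C, [/\ definable C, C `<=` X, G `<=` C & C `<=` U].
Proof.
move=> cX dX cG oU GX GU.
pose D := [set C | [/\ definable C, C `<=` X & C `<=` U]].
pose B (C : set (type_space A n)) := G `\` C.
apply: contrapT => noC.
have FF : ProperFilter (filter_from D B).
  apply: filter_from_proper.
    apply: filter_from_filter.
      by exists set0; split; [exact: definable0 | exact: sub0set | exact: sub0set].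
    move=> C C' [dC CX CU] [dC' CX' CU']; exists (C `|` C').
      by split; [exact: definableU| |]; rewrite subUset.
    by move=> q [Gq nCq]; split; split=> // Cq; apply: nCq; [left|right].
  move=> C [dC CX CU]; apply: contrapT => BC0; apply: noC; exists C.
  by split=> // q Gq; apply: contrapT => nCq; apply: BC0; exists q.
have cptG := subclosed_compact cG (@compact_types _ _ _ _ sat n) (@subsetT _ G).
have [|q [Gq clq]] := cptG _ FF.
  exists set0; last by move=> q [].
  by split; [exact: definable0 | exact: sub0set | exact: sub0set].
have [C [dC CX Cq CF]] : exists C, [/\ definable C, C `<=` X,
    @interior (subspace X) C q & C `&` (X `\` U) = set0].
  apply: dX.
  - exact: GX.
  - by apply: closedI => //; exact: open_closedC.
  - by move=> r [].
  - by move=> [_]; apply; exact: GU.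
have CU : C `<=` U.
  move=> r Cr; apply: contrapT => nUr.
  have : (C `&` (X `\` U)) r by split=> //; split=> //; exact: CX.
  by rewrite CF.
have [V Vq CV] := (nbhs_subspace_ex C (GX q Gq)).1 Cq.
have [|r [[Gr nCr] Vr]] := clq (G `\` C) V _ Vq; first by exists C.
apply: nCr; have : (V `&` X) r by split=> //; exact: GX.
by rewrite -CV => -[].
Qed.

(** Each point of [C] is within [e] of a point of [D], and that point lies in the closed set which
    [C'] is made to contain. *)
Lemma definable_step (X C D : set (type_space A n)) (e e' : R) :
  closed X -> dictionaric X -> 0 < e -> 0 < e' ->
  definable D -> D `<=` X -> definable C -> C `<=` thickening D e ->
  exists C', [/\ definable C', C' `<=` X & C' `<=` thickening D e'] /\
    [/\ D `&` C `<=` C', C `<=` thickening C' e & C' `<=` thickening C (2 * e)].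
Proof.
move=> cX dX e0 e'0 dD DX dC CD.
have [U [oU DU Ue']] := dD.2 e' e'0.
(* An open set needs a radius strictly above [e]; [2 * e] keeps the successive distances
   summable. *)
have [V [oV CV Ve]] : exists V,
    [/\ open V, cthickening C e `<=` V & V `<=` thickening C (2 * e)].
  by apply: definable_nbhs => //; lra.
have [||||C' [dC' CX' GC CU']] :=
  @dictionaric_cover X (D `&` cthickening C e) (U `&` V) cX dX.
- by apply: closedI; [exact: dD.1 | exact: cthickening_closed dC.1].
- exact: openI.
- by move=> q [Dq _]; exact: DX.
- by move=> q [Dq Cq]; split; [exact: DU|exact: CV].
exists C'; split; split=> //.
- by move=> q /CU' [/Ue'].
- move=> q [Dq Cq]; apply: GC; split=> //.
  by apply: thickening_sub_cthickening; exact: sub_thickening.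
- move=> q Cq; have /thickeningP[a [b [Da bq lt]]] := CD q Cq.
  apply/thickeningP; exists a, b; split=> //; apply: GC; split=> //.
  apply: thickening_sub_cthickening; apply/thickeningP; exists b, a.
  by rewrite bq tuple_dist_sym.
- by move=> q /CU' [_ /Ve].
Qed.

(** The distances [r k] halve, so those from [k] on add up to at most [2 * r k]; the closed
    thickenings with these radii intersect in the metric limit. *)
Lemma definable_limit (C : nat -> set (type_space A n)) (r : nat -> R) :
  (forall k, 0 < r k) -> (forall k, 2 * r k.+1 = r k) ->
  (forall e, 0 < e -> exists k, r k < e) ->
  (forall k, definable (C k)) ->
  (forall k, C k `<=` thickening (C k.+1) (r k)) ->
  (forall k, C k.+1 `<=` thickening (C k) (r k)) ->
  definable (\bigcap_k cthickening (C k) (2 * r k)).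
Proof.
move=> r0 r2 rlim dC Cup Cdn; set L' := \bigcap_k _.
have up m k : C k `<=` thickening (C (k + m)%N) (2 * r k).
  elim: m k => [|m IH] k q Ckq.
    by rewrite addn0; apply: sub_thickening => //; rewrite mulr_gt0.
  have : thickening (thickening (C (k.+1 + m)%N) (2 * r k.+1)) (r k) q.
    by apply: thickeningS (Cup k q Ckq) => //; exact: IH.
  by move=> /thickeningD; rewrite addSnnS r2 mulr2n mulrDl mul1r.
have dn m k : C (k + m)%N `<=` thickening (C k) (2 * r k).
  elim: m k => [|m IH] k q.
    by rewrite addn0 => Ckq; apply: sub_thickening => //; rewrite mulr_gt0.
  rewrite -addSnnS => /IH; rewrite r2.
  move=> /(thickeningS (Cdn k) (lexx _)) /thickeningD.
  by rewrite mulr2n mulrDl mul1r.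
have clL k : closed (cthickening (C k) (2 * r k)).
  by apply: cthickening_closed; exact: (dC k).1.
(* A cluster point of points of [C (k + m)] near [q] lies in every closed thickening. Its distance
   to [q] is at most [2 * r k]; the radius [3 * r k] makes this strict. *)
have near_limit k : C k `<=` thickening L' (3 * r k).
  move=> q Ckq.
  have /choice[p pP] : forall m, exists p,
      C (k + m)%N p /\ thickening [set q] (2 * r k) p.
    move=> m; have /thickeningP[a [b [Ca bq lt]]] := up m k q Ckq.
    exists (tp a); split=> //; apply/thickeningP; exists b, a; split=> //.
    by rewrite tuple_dist_sym.
  have [p0 [_ clp]] := @compact_types _ _ _ _ sat n (p @ \oo) _ filterT.
  have clp' F : closed F -> (\forall m \near \oo, F (p m)) -> F p0.
    by move=> cF Fp; apply: cF => W Wp0; exact: clp.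
  have Lp0 : L' p0.
    move=> j _; apply: clp' => //; exists j => // m /= jm.
    apply: thickening_sub_cthickening; have := (pP m).1.
    have -> : (k + m = j + (k + m - j))%N.
      by rewrite subnKC// (leq_trans jm)// leq_addl.
    exact: dn.
  have : cthickening [set q] (2 * r k) p0.
    apply: clp'; first by apply: cthickening_closed; exact: closed_type1.
    by apply: filterE => m; apply: thickening_sub_cthickening; exact: (pP m).2.
  have lt23 : 2 * r k < 3 * r k by have := r0 k; lra.
  move=> /(cthickening_sub_thickening lt23) /thickeningP[b [a [bq ap lt]]].
  by apply/thickeningP; exists a, b; rewrite ap tuple_dist_sym.
split; first by apply: closed_bigI => k _; exact: clL.
(* Going from [U] to [C k] and from there to [L'] costs [3 * r k] each. *)
move=> e e0; have [k rk] : exists k, r k < e / 6 by apply: rlim; rewrite divr_gt0.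
have lt23 : 2 * r k < 3 * r k by have := r0 k; lra.
have [U [oU CU Ue]] := definable_nbhs (dC k) lt23.
exists U; split=> //; first by move=> q Lq; apply: CU; exact: Lq.
move=> q /Ue /(thickeningS (@near_limit k) (lexx _)) /thickeningD.
by apply: thickeningS => //; lra.
Qed.

End Thickenings.

(** * Interpolation inside [D] with halving errors *)

Lemma halving_small (R : realType) (x e : R) : 0 <= x -> 0 < e ->
  exists k, x / 2 ^+ k < e.
Proof.
(* Since [k < 2 ^ k], an Archimedean bound for [x / e] can serve as exponent. *)
move=> x0 e0; exists (Num.bound (x / e)).
have xe : x / e < (Num.bound (x / e))%:R.
  by apply: archi_boundP; rewrite divr_ge0// ltW.
rewrite ltr_pdivrMr ?exprn_gt0// mulrC -ltr_pdivrMr// (lt_le_trans xe)//.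
by rewrite -natrX ler_nat ltnW// ltn_expl.
Qed.

Section Core.
Context (R : realType) (L : signature R) (M : structure L) (A : set M).
Context (sat : forall n (p : type_space A n), realizations p !=set0).
Context (n : nat).

Lemma definable_between (X D C0 : set (type_space A n)) (e : R) :
  closed X -> dictionaric X -> 0 < e -> definable D -> D `<=` X ->
  definable C0 -> C0 `<=` thickening D e ->
  exists C, [/\ definable C, D `&` C0 `<=` C, C `<=` D &
    C `<=` thickening C0 (5 * e)].
Proof.
move=> cX dX e0 dD DX dC0 C0D.
pose eps k := e / 2 ^+ k.
have eps0 k : 0 < eps k by rewrite divr_gt0// exprn_gt0.
have epsS k : 2 * eps k.+1 = eps k.
  by rewrite /eps exprS; field; rewrite expf_neq0.
pose good k C := definable C /\ C `<=` thickening D (eps k).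
(* [choice] yields a total function; its value on pairs that are not good is [set0]. *)
have /choice[next nextP] : forall kC : nat * set (type_space A n), exists C',
    good kC.1 kC.2 -> good kC.1.+1 C' /\
    [/\ D `&` kC.2 `<=` C', kC.2 `<=` thickening C' (eps kC.1) &
        C' `<=` thickening kC.2 (2 * eps kC.1)].
  move=> [k C]; have [[dC CD]|ng] := pselect (good k C); last by exists set0.
  have [C' [[dC' _ CD'] ?]] :=
    definable_step sat cX dX (eps0 k) (eps0 k.+1) dD DX dC CD.
  by exists C'.
pose C := fix C k := if k is j.+1 then next (j, C j) else C0.
have goodC k : good k (C k).
  elim: k => [|k IH]; first by split=> //; rewrite /eps expr0 divr1.
  exact: (nextP (k, C k) IH).1.
have CP k := (nextP (k, C k) (goodC k)).2.
(* Consecutive sets are within [2 * eps k], so the limit is taken with [r k = 2 * eps k] and the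
   radii are [4 * eps k]. *)
exists (\bigcap_k cthickening (C k) (2 * (2 * eps k))); split.
- apply: (definable_limit sat (r := fun k => 2 * eps k)) => [k|k|d d0|k|k|k].
  + by rewrite mulr_gt0.
  + by rewrite epsS.
  + have [k kd] := @halving_small _ (2 * e) d (mulr_ge0 (ler0n _ _) (ltW e0)) d0.
    by exists k; rewrite /eps mulrA.
  + exact: (goodC k).1.
  + have [_ up _] := CP k; apply: subset_trans up _; apply: thickeningS => //.
    by have := eps0 k; lra.
  + by have [_ _] := CP k.
- move=> q [Dq Cq] k _.
  have Ckq : C k q by elim: k => [//|k IH]; have [keep _ _] := CP k; exact: keep.
  apply: thickening_sub_cthickening; apply: sub_thickening => //.
  by have := eps0 k; lra.
- move=> q Lq; apply: (closed_thickeningI sat dD.1) => d d0.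
  (* [q] is within [5 * eps k] of [C k], which is within [eps k] of [D]; the total [6 * eps k]
     becomes arbitrarily small. *)
  have [k kd] := @halving_small _ (6 * e) d (mulr_ge0 (ler0n _ _) (ltW e0)) d0.
  have lt45 : 2 * (2 * eps k) < 5 * eps k by have := eps0 k; lra.
  have := cthickening_sub_thickening lt45 (Lq k I).
  move=> /(thickeningS (goodC k).2 (lexx _)) /(thickeningD sat).
  by apply: thickeningS => //; move: kd; rewrite -mulrA -/(eps k); lra.
- move=> q /(_ 0%N I); apply: cthickening_sub_thickening.
  by rewrite /eps expr0 divr1; lra.
Qed.

End Core.

Theorem corollary4p9 (R : realType) (L : signature R)
    (M : structure L) (K : Type)
    (K_infinite : infinite_set [set: K]) (M_sat : saturated M K)
    (A : set M) (A_small : ~~ ([set: K] #<= A)) (n : nat)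
    (X : set (type_space A n))
    (X_space : X = setT \/ definable X) (X_dict : dictionaric X)
    (D E : set (type_space A n))
    (D_def : definable D) (DX : D `<=` X)
    (E_def : definable E) (EX : E `<=` X)
    (eps : R) (eps_gt0 : 0 < eps) :
  exists E' : set (type_space A n),
    [/\ definable E', E `<=` E', E' `<=` X, definable (D `&` E') &
        (hausdorff_dist E E' < eps%:E)%E].
Proof.
have sat m (p : type_space A m) : realizations p !=set0 by exact: M_sat.
have cX : closed X by case: X_space => [->|[]//]; exact: closedT.
(* [C0] will be within [e] of [E], and [C] within [5 * e] of [C0]; the sum [6 * e] is strictly below
   [8 * e]. *)
pose e := eps / 8; have e0 : 0 < e by rewrite divr_gt0.
have [U [oU DU Ue]] := D_def.2 e e0; have [V [oV EV Ve]] := E_def.2 e e0.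
have [||||C0 [dC0 C0X DEC0 C0UV]] :=
  @dictionaric_cover _ _ _ _ sat n X (D `&` E) (U `&` V) cX X_dict.
- exact: closedI D_def.1 E_def.1.
- exact: openI.
- by move=> q [/DX].
- exact: setISS.
have [|C [dC DC0C CD Ce]] :=
  @definable_between _ _ _ _ sat n X D C0 e cX X_dict e0 D_def DX dC0.
  by move=> q /C0UV [/Ue].
have CE : C `<=` thickening E (6 * e).
  have C0E : C0 `<=` thickening E e by move=> q /C0UV [_ /Ve].
  move=> q /Ce /(thickeningS C0E (lexx _)) /(thickeningD sat).
  by apply: thickeningS => //; lra.
exists (E `|` C); split.
- exact: definableU.
- by move=> q; left.
- by rewrite subUset; split=> // q /CD /DX.
(* A common point of [D] and [E] lies in [C0], hence in [C]. *)
- suff -> : D `&` (E `|` C) = C by [].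
  apply/seteqP; split=> [q [Dq [Eq|//]]|q Cq]; last by split; [exact: CD|right].
  by apply: DC0C; split=> //; exact: DEC0.
(* A supremum of strict bounds is only weakly bounded; strictness comes from [6 * e < eps]. *)
have le6 (P Q : set (type_space A n)) : P `<=` thickening Q (6 * e) ->
    (ereal_sup [set dist_to p Q | p in P] <= (6 * e)%:E)%E.
  by move=> PQ; apply: ge_ereal_sup => _ [p /PQ /ltW pQ <-].
have lt6 : ((6 * e)%:E < eps%:E)%E by rewrite lte_fin /e; lra.
apply: le_lt_trans lt6; rewrite /hausdorff_dist ge_max !le6//.
  by rewrite subUset; split=> //; apply: sub_thickening => //; lra.
apply: subset_trans (_ : E `|` C `<=` _); first by move=> q; left.
by apply: sub_thickening => //; lra.
Qed.
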